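(* Let $V$ be a finite-dimensional real vector space with a positive definite scalar product $\langle\;,\;\rangle$, and let $\{\alpha_i\}_{i\in\Gamma}$ be a basis of $V$ such that $\langle\alpha_i,\alpha_j\rangle\le 0$ for all $i\ne j$. Then the retraction $\mathfrak{L}:V\to V^+$ is order-preserving, i.e. for all $x,x'\in V$ with $x\le x'$ one has $\mathfrak{L}(x)\le\mathfrak{L}(x')$.
   Context: Let $\{\omega_i\}_{i\in\Gamma}$ be the basis of $V$ dual to $\{\alpha_i\}$ with respect to the scalar product, i.e. $\langle\alpha_i,\omega_j\rangle=\delta_{ij}$. Let $V^+\subset V$ be the closed convex cone generated by the $\omega_i$, $i\in\Gamma$; equivalently $V^+=\{y\in V: \langle\alpha_i,y\rangle\ge 0 \text{ for all } i\in\Gamma\}$. The Langlands retraction $\mathfrak{L}:V\to V^+$ is defined by letting $\mathfrak{L}(x)$ be the point of $V^+$ closest to $x$ (in the Euclidean metric given by $\langle\;,\;\rangle$); it exists and is unique because $V^+$ is closed and convex. Let $V^{pos}$ be the closed convex cone generated by the $\alpha_i$, $i\in\Gamma$. The partial ordering on $V$ (and on $V^+$) is: $x\le y$ if $y-x\in V^{pos}$. *)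

(* Defs.v *)
From HB Require Import structures.
From mathcomp Require Import all_boot all_order all_algebra.
From mathcomp Require Import all_classical.
From mathcomp Require Import reals.

Set Implicit Arguments.
Unset Strict Implicit.
Unset Printing Implicit Defensive.

Import Order.TTheory GRing.Theory Num.Theory.
Local Open Scope classical_set_scope.
Local Open Scope ring_scope.

(* The family is finite, so the set of nonnegative combinations is already
   closed: it is the closed convex cone generated by the family. *)
Definition cone (R : realType) (V : vectType R) (I : finType) (v : I -> V) :
    set V :=
  [set x | exists2 c : I -> R, (forall i, 0 <= c i) & x = \sum_i c i *: v i].

Section Langlands.
Variables (R : realType) (V : vectType R) (dot : {dot V for idfun}).
Variables (I : finType) (alpha : I -> V).

(* When alpha is a basis the vector selected here exists and is unique, see
   dual_basisP and dual_basis_unique; 0 is a default value. *)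
Definition dual_basis (i : I) : V :=
  xget 0 [set w | forall j, dot (alpha j) w = (j == i)%:R].

Definition Vplus : set V := cone dual_basis.

Definition Vpos : set V := cone alpha.

Definition le_pos (x y : V) : Prop := Vpos (y - x).

Definition dist (x y : V) : R := Num.sqrt (dot (x - y) (x - y)).

Definition closest (A : set V) (x y : V) : Prop :=
  A y /\ forall z, A z -> dist x y <= dist x z.

(* 0 is a default value: when alpha is a basis, Vplus is nonempty, closed and
   convex, so that the closest point exists and is unique. *)
Definition langlands (x : V) : V := xget 0 [set y | closest Vplus x y].

Hypothesis alphaB : basis_of {:V} [seq alpha i | i : I].

Lemma basis_decomp v : exists c : I -> R, v = \sum_i c i *: alpha i.
Proof.
have : v \in <<[seq alpha i | i : I]>>%VS by rewrite (span_basis alphaB) memvf.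
rewrite /image_mem; elim: (enum _) v => [|a s IHs] v /=.
  rewrite span_nil memv0 => /eqP->; exists (fun=> 0).
  by rewrite big1 // => i _; rewrite scale0r.
rewrite span_cons => /memv_addP[u /vlineP[k ->] [w /IHs[c ->] ->]].
exists (fun i => k * (i == a)%:R + c i).
under [RHS]eq_bigr do rewrite scalerDl.
rewrite big_split /=; congr (_ + _); rewrite (bigD1 a) //= eqxx mulr1 big1 ?addr0 //.
move=> i /negbTE->.
by rewrite mulr0 scale0r.
Qed.

Lemma dot_basis_inj u w :
  (forall j, dot (alpha j) u = dot (alpha j) w) -> u = w.
Proof.
move=> eq_uw; have [c uwE] := basis_decomp (u - w).
apply/eqP; rewrite -subr_eq0; apply/negPn/negP => uw0.
have := @neq0_dnorm_gt0 _ _ _ dot _ uw0.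
rewrite {1}uwE linear_sumlz big1 ?ltxx // => i _.
by rewrite linearZl_LR linearBr /= eq_uw subrr mulr0.
Qed.

Lemma dual_basisP i j : dot (alpha j) (dual_basis i) = (j == i)%:R.
Proof.
suff [w Pw] : exists w, forall j, dot (alpha j) w = (j == i)%:R.
  by move: j; rewrite /dual_basis; case: xgetP => // /(_ w) /(_ Pw).
pose f (v : V) : 'rV[R]_#|I| := \row_k dot (alpha (enum_val k)) v.
have fL : linear f by move=> a u v; apply/rowP=> k; rewrite !mxE linearPr.
pose fl := GRing.isLinear.Build _ _ _ _ f fL.
pose fM : {linear V -> 'rV[R]_#|I|} := HB.pack f fl.
have fE v : linfun fM v = f v by rewrite lfunE.
have kf : lker (linfun fM) = 0%VS.
  apply/eqP/lker0P => u w; rewrite !fE => /rowP fuw; apply: dot_basis_inj => k.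
  by have := fuw (enum_rank k); rewrite !mxE enum_rankK.
have dV : \dim {:V} = #|I|.
  have := size_basis (X := in_tuple [seq alpha i | i : I]) alphaB.
  by rewrite /= size_image.
have : delta_mx 0 (enum_rank i) \in limg (linfun fM).
  suff -> : limg (linfun fM) = fullv by rewrite memvf.
  apply/eqP; rewrite eqEdim subvf /= limg_dim_eq ?kf ?capv0 //.
  by rewrite dV dimvf /dim /= mul1n.
case/memv_imgP=> w _; rewrite fE => /rowP fw; exists w => k.
by have := fw (enum_rank k); rewrite !mxE eqxx enum_rankK (inj_eq enum_rank_inj).
Qed.

Lemma dual_basis_unique (w : I -> V) :
  (forall i j, dot (alpha j) (w i) = (j == i)%:R) -> w =1 dual_basis.
Proof. by move=> Pw i; apply: dot_basis_inj => j; rewrite Pw dual_basisP. Qed.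

Lemma VplusE : Vplus = [set y | forall i, 0 <= dot (alpha i) y].
Proof.
have dotS (c : I -> R) i : dot (alpha i) (\sum_j c j *: dual_basis j) = c i.
  rewrite linear_sumr (bigD1 i) //= big1 => [|j ji].
    by rewrite addr0 linearZr_LR /= dual_basisP eqxx mulr1.
  by rewrite linearZr_LR /= dual_basisP eq_sym (negbTE ji) mulr0.
apply/seteqP; split=> [y [c c0 ->] i|y y0]; first by rewrite dotS.
exists (fun i => dot (alpha i) y) => //.
by apply: dot_basis_inj => i; rewrite dotS.
Qed.
End Langlands.

(* Main.v *)
Require Import Defs.
From mathcomp Require Import all_boot all_order all_algebra.
From mathcomp Require Import reals.
From mathcomp Require Import classical_sets lra.

(** The point [L x] closest to [x] in the cone [V+] is also the least element,
    for the order whose positive cone is generated by the [alpha i], of the set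
    of all [z] in [V+] with [x <= z].  Monotonicity is then immediate: if
    [x <= x'], then [L x'] lies in [V+] and [x <= x' <= L x'], so
    [L x <= L x'].

    The link between the two descriptions is the complementarity system
    [y = x + \sum_i c i *: alpha i] with [c i >= 0], [dot (alpha i) y >= 0] and
    [c i * dot (alpha i) y = 0].  A solution [y] is the unique closest point
    by expanding the square of [x - z] around [y] ([closest_complementary]), and
    it is the least point of [V+] above [x] by the comparison principle
    [comb_coef_ge0]: since the [alpha i] are pairwise obtuse, a combination of
    them whose scalar product with [alpha i] is nonnegative at each negative
    coefficient has no negative coefficient at all.

    The complementarity system is solved without any compactness argument
    ([complementary_exists]).  Start from [y = x]; as long as some
    [dot (alpha i) y] is negative, add [i] to the set of active indices and
    replace [y] by its projection onto the orthogonal complement of the active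
    [alpha j].  By the comparison principle each such move increases the
    coefficients, so they remain nonnegative and no index ever has to be
    removed; the process stops because the index set is finite. *)

Set Implicit Arguments.
Unset Strict Implicit.
Unset Printing Implicit Defensive.

Import Order.TTheory GRing.Theory Num.Theory.
Local Open Scope ring_scope.

(** * Positive definite forms over a real field *)

Section DotForm.
Variables (R : realType) (V : vectType R) (dot : {dot V for idfun}).

Lemma dotC u v : dot u v = dot v u.
Proof. by rewrite hermC expr0 mul1r. Qed.

Lemma dot_ge0 u : 0 <= dot u u.
Proof.
have [->|u0] := eqVneq u 0; first by rewrite linear0l.
by rewrite ltW // neq0_dnorm_gt0.
Qed.

Lemma dot_le0_eq0 u : dot u u <= 0 -> u = 0.
Proof.
move=> u_le0; apply/eqP/negPn/negP => u0.
by have := @neq0_dnorm_gt0 _ _ _ dot _ u0; rewrite ltNge u_le0.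
Qed.

Lemma dotDD u v : dot (u + v) (u + v) = dot u u + dot v v + dot u v *+ 2.
Proof. by rewrite linearDl /= !linearDr /= (dotC v u); lra. Qed.

Lemma dot_sumZl (I : finType) (alpha : I -> V) (c : I -> R) v :
  dot (\sum_i c i *: alpha i) v = \sum_i c i * dot (alpha i) v.
Proof. by rewrite linear_sumlz; apply: eq_bigr => i _; rewrite linearZl_LR. Qed.

End DotForm.

Section Retraction.
Variables (R : realType) (V : vectType R) (dot : {dot V for idfun}).
Variables (I : finType) (alpha : I -> V).

Local Notation comb c := (\sum_i c i *: alpha i).

Lemma combD (c d : I -> R) : comb (fun i => c i + d i) = comb c + comb d.
Proof. by rewrite -big_split; apply: eq_bigr => i _; rewrite scalerDl. Qed.

Lemma combB (c d : I -> R) : comb (fun i => c i - d i) = comb c - comb d.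
Proof. by rewrite -sumrB; apply: eq_bigr => i _; rewrite scalerBl. Qed.

Lemma combZ k (c : I -> R) : comb (fun i => k * c i) = k *: comb c.
Proof. by rewrite scaler_sumr; apply: eq_bigr => i _; rewrite scalerA. Qed.

Lemma comb_delta i : comb (fun j => (j == i)%:R : R) = alpha i.
Proof.
rewrite (bigD1 i) //= eqxx scale1r big1 ?addr0 // => j /negbTE->.
by rewrite scale0r.
Qed.

(** * Projection away from finitely many vectors *)

(** Gram-Schmidt.  When [alpha i] joins the list, [r], its own residual
    modulo the previous vectors, is the direction to remove.  If [r = 0],
    division by zero leaves the residual unchanged, which is right since
    [alpha i] is then a combination of the previous vectors. *)
Lemma residual_exists (s : seq I) (v : V) :
  exists2 c : I -> R, (forall i, i \notin s -> c i = 0) &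
    forall j, j \in s -> dot (alpha j) (v + comb c) = 0.
Proof.
elim: s v => [|i s IHs] v.
  by exists (fun=> 0).
have [c cs cP] := IHs v; have [a as0 aP] := IHs (alpha i).
set w := v + comb c in cP; set r := alpha i + comb a in aP.
pose t := - (dot r w / dot r r).
exists (fun j => c j + t * ((j == i)%:R + a j)) => [j|].
  rewrite inE negb_or => /andP[/negbTE-> js].
  by rewrite cs // as0 // addr0 mulr0 addr0.
rewrite combD combZ combD comb_delta addrA -/w -/r => j.
have ortho k : k \in s -> dot (alpha k) (w + t *: r) = 0.
  by move=> ks; rewrite linearDr linearZr_LR /= cP // aP // mulr0 addr0.
rewrite inE => /orP[/eqP->|/ortho //].
have -> : alpha i = r - comb a by rewrite addrK.
rewrite linearBl /= dot_sumZl [X in _ - X]big1 ?subr0; last first.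
  move=> k _; have [/ortho->|/as0->] := boolP (k \in s); first by rewrite mulr0.
  by rewrite mul0r.
rewrite linearDr linearZr_LR /= /t.
have [->|r0] := eqVneq r 0; first by rewrite !linear0l mulr0 addr0.
by rewrite mulNr divfK ?subrr // gt_eqF // neq0_dnorm_gt0.
Qed.

Hypothesis alphaB : basis_of fullv [seq alpha i | i : I].
Hypothesis alpha_obtuse : forall i j, i != j -> dot (alpha i) (alpha j) <= 0.

(** * The comparison principle for obtuse bases *)

Lemma comb_eq0 (c : I -> R) : comb c = 0 -> forall i, c i = 0.
Proof.
move=> c0 i; have : dot (comb c) (dual_basis dot alpha i) = 0.
  by rewrite c0 linear0l.
rewrite dot_sumZl (bigD1 i) //= dual_basisP // eqxx mulr1 big1 ?addr0 //.
by move=> j /negbTE ji; rewrite dual_basisP // ji mulr0.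
Qed.

(** Split [e = m + p] into its negative and positive parts.  Obtuseness makes
    [dot (comb m) (comb p)] nonnegative, so [dot (comb m) (comb m)] is at most
    [dot (comb m) (comb e)], which the hypothesis makes nonpositive. *)
Lemma comb_coef_ge0 (e : I -> R) :
  (forall i, e i < 0 -> 0 <= dot (alpha i) (comb e)) -> forall i, 0 <= e i.
Proof.
move=> eP; pose m i := if e i < 0 then e i else 0; pose p i := e i - m i.
have m_le0 i : m i <= 0 by rewrite /m; case: ifP => // /ltW.
have p_ge0 i : 0 <= p i.
  by rewrite /p /m; case: ltP => [_|]; rewrite ?subrr ?subr0.
have mp0 i : m i * p i = 0.
  by rewrite /p /m; case: ifP => _; rewrite ?subrr ?mulr0 ?mul0r.
have me_le0 : dot (comb m) (comb e) <= 0.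
  rewrite dot_sumZl sumr_le0 // => i _; rewrite /m.
  by case: ifP => [ei|_]; rewrite ?mul0r // mulr_le0_ge0 ?eP // ltW.
have mp_ge0 : 0 <= dot (comb m) (comb p).
  rewrite dot_sumZl sumr_ge0 // => i _.
  rewrite dotC dot_sumZl mulr_sumr sumr_ge0 // => j _.
  have [->|ji] := eqVneq j i; first by rewrite mulrA mp0 mul0r.
  by rewrite mulr_le0 // mulr_ge0_le0 // alpha_obtuse.
have m0 : comb m = 0.
  apply: (@dot_le0_eq0 _ _ dot); apply: le_trans me_le0.
  by rewrite -subr_ge0 -linearBr /= -combB.
move=> i; rewrite leNgt; apply/negP => ei.
by have := comb_eq0 m0 i; rewrite /m ei => ei0; rewrite ei0 ltxx in ei.
Qed.

(** * The complementarity system *)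

(** The Karush-Kuhn-Tucker conditions for minimizing the distance to [x] on
    [Vplus], with multipliers [c]. *)
Definition complementary (x : V) (c : I -> R) : Prop :=
  [/\ forall i, 0 <= c i,
      forall i, 0 <= dot (alpha i) (x + comb c) &
      forall i, c i * dot (alpha i) (x + comb c) = 0].

(** One run of the active set process, by induction on the number of inactive
    indices: [s] lists the active ones, which carry all the multipliers and
    whose [alpha i] are orthogonal to the current point [x + comb c]. *)
Lemma complementary_extend x (s : seq I) (c : I -> R) :
    (forall i, 0 <= c i) -> (forall i, i \notin s -> c i = 0) ->
    (forall i, i \in s -> dot (alpha i) (x + comb c) = 0) ->
  exists d, complementary x d.
Proof.
have [n] := ubnP #|[pred i | i \notin s]|.
elim: n s c => // n IHn s c; rewrite ltnS => s_n c_ge0 cs cP.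
have [y_ge0|] := boolP [forall i, 0 <= dot (alpha i) (x + comb c)].
  exists c; split=> // i; first exact: forallP y_ge0 i.
  by have [/cP->|/cs->] := boolP (i \in s); rewrite ?mulr0 ?mul0r.
rewrite negb_forall => /existsP[i]; rewrite -ltNge => yi.
have is' : i \notin s by apply/negP => /cP y0; rewrite y0 ltxx in yi.
have [d ds dP] := residual_exists (i :: s) (x + comb c).
rewrite -addrA -combD in dP.
(* The correction [comb d] is orthogonal to the old active vectors and has
   positive product with [alpha i], so the comparison principle applies. *)
have d_ge0 : forall j, 0 <= d j.
  apply: comb_coef_ge0 => j dj.
  have js : j \in i :: s.
    by apply/negPn/negP => /ds dj0; rewrite dj0 ltxx in dj.
  have := dP j js; rewrite combD addrA linearDr /= => /eqP.
  rewrite addr_eq0 => /eqP yd; rewrite -oppr_le0 -yd.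
  by move: js; rewrite inE => /orP[/eqP->|/cP->//]; apply: ltW.
apply: (IHn (i :: s) (fun j => c j + d j)) => //; first last.
- move=> j js; rewrite ds // addr0 cs //.
  by move: js; rewrite inE negb_or => /andP[].
- by move=> j; rewrite addr_ge0.
apply: leq_trans s_n; apply: proper_card; apply/properP; split.
  by apply/fintype.subsetP => j; rewrite !inE negb_or => /andP[].
by exists i; rewrite !inE ?eqxx.
Qed.

Lemma complementary_exists x : exists c, complementary x c.
Proof. by apply: (@complementary_extend x [::] (fun=> 0)). Qed.

(** Complementarity at [y] gives, for [z] in [Vplus],
    [dot (x - y) (y - z) = \sum_i c i * dot (alpha i) z >= 0]: seen from [y],
    the directions of [x] and [z] make an angle that is not acute. *)
Lemma complementary_pythagoras x c y z :
    complementary x c -> y = x + comb c -> Vplus dot alpha z ->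
  dot (x - y) (x - y) + dot (y - z) (y - z) <= dot (x - z) (x - z).
Proof.
move=> [c_ge0 _ cy] yE; rewrite VplusE // => z_ge0.
have xz : x - z = (x - y) + (y - z) by rewrite addrA subrK.
have cross : 0 <= dot (x - y) (y - z).
  have -> : x - y = - comb c by rewrite yE opprD addrA subrr add0r.
  rewrite linearNl /= dot_sumZl -sumrN sumr_ge0 // => i _.
  by rewrite linearBr /= mulrBr yE cy sub0r opprK mulr_ge0 // z_ge0.
by rewrite xz (dotDD _ (x - y)) lerDl mulrn_wge0.
Qed.

Lemma closest_complementary x c : complementary x c ->
  langlands dot alpha x = x + comb c.
Proof.
move=> cx; set y := x + comb c.
have Vy : Vplus dot alpha y by rewrite VplusE //; case: cx.
have yP : closest dot (Vplus dot alpha) x y.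
  split=> // z Vz; apply: ler_wsqrtr.
  by apply: le_trans (complementary_pythagoras cx erefl Vz); rewrite lerDl dot_ge0.
rewrite /langlands; case: xgetP => [z _ [Vz zP]|/(_ y)//].
(* Two closest points: the Pythagorean inequality leaves no room for [y - z]. *)
apply/esym/eqP; rewrite -subr_eq0; apply/eqP/(@dot_le0_eq0 _ _ dot).
have := complementary_pythagoras cx erefl Vz; rewrite -/y.
have := zP y Vy; rewrite /dist ler_sqrt ?dot_ge0 // => zy yz.
by move: zy yz; lra.
Qed.

(** * The retraction as a least element *)

Lemma langlands_ge x : le_pos alpha x (langlands dot alpha x).
Proof.
have [c cx] := complementary_exists x.
rewrite (closest_complementary cx); case: cx => c_ge0 _ _.
by exists c => //; rewrite addrC addKr.
Qed.

Lemma langlands_Vplus x : Vplus dot alpha (langlands dot alpha x).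
Proof.
have [c cx] := complementary_exists x.
by rewrite (closest_complementary cx) VplusE //; case: cx.
Qed.

(** A coefficient of [z - L x] can be negative only where the multiplier [c i]
    is positive; there [L x] is orthogonal to [alpha i], so [z - L x] has
    nonnegative product with it and the comparison principle applies. *)
Lemma langlands_least x z : Vplus dot alpha z -> le_pos alpha x z ->
  le_pos alpha (langlands dot alpha x) z.
Proof.
rewrite VplusE // => z_ge0 [d d_ge0 zE].
have [c cx] := complementary_exists x; rewrite (closest_complementary cx).
case: cx => c_ge0 _ cy.
have zyE : z - (x + comb c) = comb (fun i => d i - c i).
  by rewrite combB -zE opprD addrA.
exists (fun i => d i - c i) => //; apply: comb_coef_ge0 => i dci.
have ci : c i != 0.
  by apply/negP => /eqP ci; move: dci; rewrite ci subr0 ltNge d_ge0.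
rewrite -zyE linearBr /=; have /eqP := cy i; rewrite mulf_eq0 (negbTE ci) /=.
by move=> /eqP->; rewrite subr0 z_ge0.
Qed.

Lemma le_pos_trans (x y z : V) :
  le_pos alpha x y -> le_pos alpha y z -> le_pos alpha x z.
Proof.
move=> [c c_ge0 yE] [d d_ge0 zE]; exists (fun i => d i + c i).
  by move=> i; rewrite addr_ge0.
by rewrite combD -yE -zE addrA subrK.
Qed.

End Retraction.

Theorem theorem3p1 (R : realType) (V : vectType R) (dot : {dot V for idfun})
    (I : finType) (alpha : I -> V)
    (alphaB : basis_of {:V} [seq alpha i | i : I])
    (alpha_obtuse : forall i j, i != j -> dot (alpha i) (alpha j) <= 0)
    (x x' : V) (xx' : le_pos alpha x x') :
  le_pos alpha (langlands dot alpha x) (langlands dot alpha x').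
Proof.
apply: langlands_least => //; first exact: langlands_Vplus.
exact: le_pos_trans xx' (langlands_ge _ _ _).
Qed.
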